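(* Fix an integer $m\ge 1$. For integers $k\ge 1$ and $r\ge 0$, let $N(k,r)$ be the number of code words of length $k$ (for base dimension $m$) in which the last subscript has cardinality $r$. If $k\le m$, then $$N(k,r)=c(k,r+1),$$ where $c(k,r+1)$ is the unsigned Stirling number of the first kind.
   Context: Symbols are $V_A$, where $A$ (the subscript) is a finite set of integers strictly greater than $1$. A code word of length $k$ (for base dimension $m$) is a sequence $V_{A_1}V_{A_2}\cdots V_{A_k}$ such that: $A_1=\emptyset$; for each $j=2,\dots,k$, $A_j\subseteq A_{j-1}\cup\{j\}$; and $|A_j|<m$ for all $j$. The last subscript is $A_k$. The unsigned Stirling number of the first kind $c(n,\ell)$ is the number of permutations of $n$ elements with exactly $\ell$ cycles. *)

(* Defs.v *)
From mathcomp Require Import all_boot all_fingroup finmap.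
From mathcomp Require Import boolp classical_sets functions cardinality.

Set Implicit Arguments.
Unset Strict Implicit.
Unset Printing Implicit Defensive.

Local Open Scope fset_scope.
Local Open Scope classical_set_scope.
Local Open Scope nat_scope.

(* The symbol V_A is represented by its subscript A. *)
Definition subscript (A : {fset nat}) : Prop :=
  forall i, i \in A -> 1 < i.

(* The word V_{A_1} ... V_{A_k} is the sequence w = [:: A_1; ...; A_k], so that
   A_j is [nth fset0 w j.-1]: the subscripts A_j are numbered from 1, the items
   of a seq from 0. *)
Definition code_word (m k : nat) (w : seq {fset nat}) : Prop :=
  [/\ size w = k /\ (forall A, A \in w -> subscript A),
      nth fset0 w 0 = fset0,
      forall j, 2 <= j <= k ->
        (nth fset0 w j.-1 `<=` nth fset0 w j.-2 `|` [fset j])%fset &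
      forall A, A \in w -> #|` A| < m].

Definition code_words_last (m k r : nat) : set (seq {fset nat}) :=
  [set w | code_word m k w /\ #|` last fset0 w| = r].

(* [fset_set] is [fset0] on infinite sets; lemma [finite_code_words_last] below
   shows that this default value plays no role here. *)
Definition num_code_words (m k r : nat) : nat :=
  #|` fset_set (code_words_last m k r)|.

(* [porbits s] is the set of all cycles of s, fixed points included. *)
Definition stirling1 (n l : nat) : nat :=
  #|[pred s : 'S_n | #|porbits s| == l]|.

Lemma code_word_bound m k w j i :
  code_word m k w -> j < k -> i \in nth fset0 w j -> i < k.+1.
Proof.
case=> _ w0 wS _ jk iw.
suff : i <= j.+1 by move/leq_ltn_trans; apply.
elim: j jk iw => [|j IHj] jk; first by rewrite w0 inE.
have /fsubsetP jS := wS j.+2 jk.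
move=> /jS; rewrite !inE => /orP[iw|/eqP -> //].
by rewrite leqW // IHj // ltnW.
Qed.

Lemma finite_code_words_last m k r : finite_set (code_words_last m k r).
Proof.
pose f (t : k.-tuple {set 'I_k.+1}) : seq {fset nat} :=
  [seq [fset val i | i in B]%fset | B : {set 'I_k.+1} <- t].
apply: (@sub_finite_set _ _ (f @` setT)); last first.
  by apply: finite_image; exact: finite_finset.
move=> w [wc _]; have [[sw _] _ _ _] := wc.
exists [tuple [set i : 'I_k.+1 | val i \in nth fset0 w j]%SET | j < k] => //.
apply: (@eq_from_nth _ fset0) => [|j]; first by rewrite size_map size_tuple sw.
rewrite size_map size_tuple => jk.
rewrite (nth_map finset.set0) ?size_tuple // -(tnth_nth _ _ (Ordinal jk)).
rewrite tnth_mktuple; apply/fsetP => i; apply/imfsetP/idP => /=.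
  by case=> a; rewrite inE => aw ->.
move=> iw; have ik := code_word_bound wc jk iw.
by exists (Ordinal ik); rewrite // inE.
Qed.

(* Main.v *)
(* Both sides have the same generating function. Writing |w| for the size of
   the last subscript of w, extending w of length n + 1 by all subsets of
   {n + 2} U (last subscript of w) gives
     F_{n+1}(x) = sum_w (1 + x)^(|w| + 1) = (x + 1) F_n(x + 1),
   so F_n(x) = (x + 1) ... (x + n), while the permutations s of n + 1 elements
   satisfy sum_s x^(number of cycles of s) = x (x + 1) ... (x + n). *)

Require Import Defs.
From mathcomp Require Import all_boot all_fingroup finmap.
From mathcomp Require Import boolp classical_sets functions cardinality.
From mathcomp Require Import all_algebra.
From mathcomp Require Import zify.

Set Implicit Arguments.
Unset Strict Implicit.
Unset Printing Implicit Defensive.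

Import GRing.Theory Num.Theory.

Lemma porbit_lift_perm0 n (i : 'I_n.+1) (s : 'S_n) :
  porbit (lift_perm i i s) i = [set i]%SET.
Proof.
apply/setP => j; rewrite inE; apply/porbitP/eqP => [[k ->]|->].
  by rewrite permX; elim: k => //= k ->; rewrite lift_perm_id.
by exists 0; rewrite expg0 perm1.
Qed.

Lemma porbit_lift_perm n (i : 'I_n.+1) (s : 'S_n) (j : 'I_n) :
  porbit (lift_perm i i s) (lift i j) = [set lift i a | a in porbit s j]%SET.
Proof.
have liftX k : (lift_perm i i s ^+ k)%g (lift i j) = lift i ((s ^+ k)%g j).
  by rewrite !permX; elim: k => //= k ->; rewrite lift_perm_lift.
apply/setP => a; apply/porbitP/imsetP => [[k ->]|[b /porbitP[k ->] ->]].
  by exists ((s ^+ k)%g j); rewrite ?liftX ?mem_porbit.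
by exists k; rewrite liftX.
Qed.

(** The lifted permutation fixes [i] and acts as [s] on the remaining points, so its cycles are
    [{i}] and the lifts of the cycles of [s]. *)
Lemma card_porbits_lift_perm n (i : 'I_n.+1) (s : 'S_n) :
  #|porbits (lift_perm i i s)| = #|porbits s|.+1.
Proof.
pose f (B : {set 'I_n}) := [set lift i a | a in B]%SET.
have f_inj : injective f by apply: imset_inj; exact: lift_inj.
have -> : porbits (lift_perm i i s) = ([set i]%SET |: f @: porbits s)%SET.
  apply/setP => B; rewrite !inE; apply/imsetP/orP => [[a _ ->]|].
    case: (unliftP i a) => [j ->|->]; last by left; rewrite porbit_lift_perm0.
    by right; rewrite porbit_lift_perm !imset_f.
  case=> [/eqP ->|/imsetP[C /imsetP[j _ ->] ->]].
    by exists i; rewrite ?porbit_lift_perm0.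
  by exists (lift i j); rewrite ?porbit_lift_perm.
rewrite cardsU1 card_imset //.
suff -> : [set i]%SET \notin (f @: porbits s)%SET by [].
apply/imsetP => -[B _ /setP/(_ i)]; rewrite inE eqxx => /esym/imsetP[a _].
by move/eqP; rewrite (negPf (neq_lift _ _)).
Qed.

(** For [j != i], the transposition merges the singleton cycle of [i] into the cycle of [j]; for
    [j = i] it is trivial and [{i}] survives as an extra cycle. *)
Lemma card_porbits_tperm_lift_perm n (i j : 'I_n.+1) (s : 'S_n) :
  #|porbits (tperm j i * lift_perm i i s)%g| = #|porbits s| + (j == i).
Proof.
have := porbits_mul_tperm (lift_perm i i s) j i.
rewrite porbit_lift_perm0 inE card_porbits_lift_perm /=.
by case: eqP => _ /=; lia.
Qed.

(** The left factor acts first, so [p.1] is the point sent to [ord0]; this is how it can be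
    recovered from the product. *)
Definition extend_perm n (p : 'I_n.+1 * 'S_n) : 'S_n.+1 :=
  (tperm p.1 ord0 * lift_perm ord0 ord0 p.2)%g.

Lemma extend_perm_bij n : bijective (@extend_perm n).
Proof.
apply: inj_card_bij; last by rewrite card_prod !card_Sn card_ord.
case=> [i s] [j t]; rewrite /extend_perm /= => E.
have ij : i = j.
  apply: (@perm_inj _ (tperm i ord0 * lift_perm ord0 ord0 s)%g).
  by rewrite {2}E !permM !tpermL !lift_perm_id.
move: E; rewrite ij => /mulgI E; congr pair; apply/permP => a.
by apply: (@lift_inj _ ord0); rewrite -!(lift_perm_lift ord0) E.
Qed.

Lemma sum_porbits (R : comNzRingType) (x : R) n :
  (\sum_(s : 'S_n) x ^+ #|porbits s| = \prod_(i < n) (x + i%:R))%R.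
Proof.
elim: n => [|n IHn].
  rewrite big_ord0 (big_pred1 1%g) => [|s].
    rewrite (_ : #|porbits _| = 0) ?expr0 //; apply/eqP.
    rewrite cards_eq0 /porbits; apply/eqP/setP => B; rewrite inE.
    by apply/imsetP => -[[]].
  by rewrite /=; apply/esym/eqP/permP => -[].
rewrite (reindex _ (onW_bij _ (extend_perm_bij n))) /=.
rewrite -(pair_bigA _ (fun i s => x ^+ #|porbits (extend_perm (i, s))|))%R /=.
rewrite exchange_big big_ord_recr /= -IHn mulr_suml; apply: eq_bigr => s _.
(* The choice [i = ord0] creates a cycle and contributes the factor [x]; each of the [n] other
   choices contributes 1. *)
rewrite big_ord_recl /extend_perm /= card_porbits_tperm_lift_perm eqxx addn1.
rewrite (eq_bigr (fun=> x ^+ #|porbits s|)%R) => [|i _].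
  by rewrite sumr_const card_ord exprSr mulrDr mulr_natr.
by rewrite card_porbits_tperm_lift_perm addn0.
Qed.

(** Expanding the product of [x + 1] over [A] chooses [x] on a subset and 1 off it. *)
Lemma sum_fpowerset (R : comNzRingType) (K : choiceType) (x : R) (A : {fset K}) :
  (\sum_(B <- fpowerset A) x ^+ #|` B| = (x + 1) ^+ #|` A|)%R.
Proof.
rewrite /fpowerset big_imfset /= => [|B C _ _ /fsetP BC]; last first.
  apply/setP => a; have := BC (val a).
  by rewrite !(mem_imfset _ _ val_inj).
rewrite cardfE -prodr_const bigA_distr /=.
rewrite big_enum /=; apply: eq_big => [B|B _].
  by rewrite powersetE finset.subsetT.
rewrite card_imfset /=; last exact: val_inj.
by rewrite -cardE -big_mkcond prodr_const.
Qed.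

(* [words n] lists the code words of length [n.+1]. *)
Fixpoint words n : seq (seq {fset nat}) :=
  if n is n'.+1 then
    [seq rcons w A | w <- words n',
                     A <- enum_fset (fpowerset (n'.+2 |` last fset0 w)%fset)]
  else [:: [:: fset0]].

Lemma uniq_words n : uniq (words n).
Proof.
elim: n => //= n IHn; apply: allpairs_uniq_dep => // [w _|].
  exact: fset_uniq.
by move=> [w A] [v B] _ _ /= /rcons_inj[-> ->].
Qed.

Lemma code_word1 m w : 0 < m -> code_word m 1 w <-> w = [:: fset0].
Proof.
move=> m0; split=> [[[]]|->].
  by case: w => // A [] // _ _ /= ->.
split=> // [|[|[|]] //|A]; first by split=> // A; rewrite inE => /eqP ->.
by rewrite inE => /eqP ->; rewrite cardfs0.
Qed.

Lemma card_last_code_word m n w :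
  code_word m n.+1 w -> #|` last fset0 w| <= n.
Proof.
case=> -[sw _] w0 wS _; rewrite -nth_last sw /=.
suff : forall j, j <= n -> #|` nth fset0 w j| <= j by apply.
elim=> [|j IHj] jn; first by rewrite w0 cardfs0.
apply: leq_trans (fsubset_leq_card (wS j.+2 jn)) _.
rewrite fsetUC cardfsU1 -[j.+1]add1n; apply: leq_add; first exact: leq_b1.
exact: IHj (ltnW jn).
Qed.

(** This makes [n.+2] a genuinely new element, so that adjoining it to the last subscript raises the
    cardinality by exactly one. *)
Lemma notin_last_code_word m n w :
  code_word m n.+1 w -> n.+2 \notin last fset0 w.
Proof.
move=> wc; have [[sw _] _ _ _] := wc; apply/negP; rewrite -nth_last sw /=.
by move/(code_word_bound wc (ltnSn n)); rewrite ltnn.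
Qed.

Lemma code_word_rcons m n w A : n.+1 < m ->
  code_word m n.+2 (rcons w A) <->
  code_word m n.+1 w /\ (A `<=` n.+2 |` last fset0 w)%fset.
Proof.
move=> nm; split=> [[[]]|[wc AS]].
  rewrite size_rcons => -[sw] wsub w0 wS wm; split; last first.
    have := wS n.+2; rewrite /= !nth_rcons sw ltnn eqxx ltnSn leqnn.
    by rewrite fsetUC -nth_last sw; apply.
  split.
  - by split=> // B Bw; apply: wsub; rewrite mem_rcons inE Bw orbT.
  - by move: w0; rewrite nth_rcons sw.
  - case=> [|[|j]] // jn; have := wS j.+2; rewrite /= !nth_rcons sw.
    have {}jn : j.+1 < n.+1 by case/andP: jn.
    by rewrite jn (ltnW jn) (leqW jn); apply.
  - by move=> B Bw; apply: wm; rewrite mem_rcons inE Bw orbT.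
have [[sw wsub] w0 wS wm] := wc; have cl := card_last_code_word wc.
have last_w : last fset0 w \in w.
  by case: (w) sw => //= B v _; rewrite mem_last.
split.
- split=> [|B]; first by rewrite size_rcons sw.
  rewrite mem_rcons inE => /orP[/eqP -> i|]; last exact: wsub.
  move/(fsubsetP AS); rewrite !inE => /orP[/eqP -> //|].
  exact: wsub last_w i.
- by rewrite nth_rcons sw.
- case=> [|[|j]] //=; rewrite ltnS leq_eqVlt => /orP[/eqP [->]|jn].
    rewrite !nth_rcons sw ltnn eqxx ltnSn fsetUC.
    by move: AS; rewrite -nth_last sw.
  by rewrite !nth_rcons sw jn ltnW //; apply: (wS j.+2).
- move=> B; rewrite mem_rcons inE => /orP[/eqP ->|]; last exact: wm.
  (* [A] has at most one element more than the last subscript of [w], hence at most [n.+1 < m]. This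
     is where the assumption [k <= m] enters. *)
  apply: leq_ltn_trans (fsubset_leq_card AS) _; rewrite cardfsU1.
  by apply: leq_ltn_trans nm; rewrite -[n.+1]add1n leq_add // leq_b1.
Qed.

Lemma mem_words m n w : n < m -> w \in words n <-> code_word m n.+1 w.
Proof.
elim: n w => [|n IHn] w nm.
  by rewrite code_word1 //= inE; split=> [/eqP|->].
split=> [/allpairsPdep[v [A [vw]]]|].
  by rewrite fpowersetE => AS ->; apply/code_word_rcons => //; rewrite -IHn // ltnW.
case: (lastP w) => [[[]] //|v A] /(code_word_rcons _ _ nm)[/IHn vw AS].
by apply/allpairsPdep; exists v, A; rewrite fpowersetE; split=> //; apply/vw/ltnW.
Qed.

Lemma sum_words (R : comNzRingType) (x : R) n :
  (\sum_(w <- words n) x ^+ #|` last fset0 w| = \prod_(i < n) (x + i.+1%:R))%R.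
Proof.
elim: n x => [|n IHn] x; first by rewrite big_seq1 big_ord0 cardfs0 expr0.
rewrite /= big_allpairs_dep /= big_ord_recl.
(* Writing [x + i.+2] as [(x + 1) + i.+1] exposes the induction hypothesis at [x + 1]; the split-off
   factor is [x + 1] itself. *)
under [X in (_ * X)%R]eq_bigr => i _ do rewrite lift0 -[i.+2%:R%R]natr1 [(_ + 1)%R]addrC addrA.
rewrite -IHn mulr_sumr big_seq [RHS]big_seq; apply: eq_bigr => w wn.
under eq_bigr => A _ do rewrite last_rcons.
(* [words] does not mention [m]; the value [n.+1] is the least one for which [mem_words] applies. *)
rewrite sum_fpowerset cardfsU1 (@notin_last_code_word n.+1 n) ?exprS; first by [].
exact/mem_words.
Qed.

(** Evaluating the generating functions at ['X] turns counts into coefficients. *)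
Lemma coef_sum_Xn (R : nzSemiRingType) (I : Type) (s : seq I) (f : I -> nat) n :
  ((\sum_(i <- s) 'X^(f i) : {poly R})`_n)%R = (count (fun i => f i == n) s)%:R%R.
Proof.
rewrite coef_sum; elim: s => [|i s IHs]; first by rewrite big_nil.
by rewrite big_cons IHs coefXn /= natrD eq_sym.
Qed.

Lemma num_code_wordsE m n r : n < m ->
  num_code_words m n.+1 r = count (fun w => #|` last fset0 w| == r) (words n).
Proof.
move=> nm; rewrite /num_code_words.
have -> : code_words_last m n.+1 r =
    [set` [fset w in words n | #|` last fset0 w| == r]%fset]%classic.
  apply/seteqP; split=> w /=.
    by case=> /(mem_words _ nm) wn wr; rewrite !inE /= wn wr eqxx.
  by rewrite !inE /= => /andP[/(mem_words _ nm) wn /eqP].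
rewrite set_fsetK card_imfset //= -size_filter.
by rewrite undup_id ?filter_uniq ?uniq_words.
Qed.

Theorem mainTheorem3 (m k r : nat) (hm : 1 <= m) (hk : 1 <= k) (hkm : k <= m) :
  num_code_words m k r = stirling1 k r.+1.
Proof.
case: k hk hkm => // n _ nm; rewrite num_code_wordsE //.
apply/eqP; rewrite -(@eqr_nat int) -(coef_sum_Xn int); apply/eqP.
rewrite sum_words /stirling1 cardE size_filter -(coef_sum_Xn int).
(* The cycle polynomial has the additional factor ['X] at index 0, which accounts for the shift from
   [r] to [r.+1]. *)
rewrite -enumT big_enum sum_porbits big_ord_recl addr0 mulrC coefMX /=.
by congr (_`_ _)%R; apply: eq_bigr => i _.
Qed.
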